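(* For any virtual shadow $S$, $$\mathrm{cl}(S)\ge\sum_{m\ne 0} |C_m|,$$ where $C_m$ denotes the set of precrossings of $S$ with intersection index $m$; that is, $\mathrm{cl}(S)$ is at least the number of precrossings of $S$ with nonzero intersection index.
   Context: A virtual knot diagram is a generic closed curve in the plane each of whose double points is either a classical crossing (over/under information given) or a virtual crossing (circled, no over/under information). A virtual knot is an equivalence class of such diagrams under planar isotopy, the classical Reidemeister moves and the virtual Reidemeister moves; equivalently, planar isotopy, the classical Reidemeister moves and the detour move (a strand containing no classical crossings may be replaced by any other strand with the same endpoints and no classical crossings, all new double points being virtual). A virtual knot is classical if it has a diagram with no virtual crossings, and non-classical otherwise. A virtual shadow is such a diagram in which the virtual crossings are given, but every other double point is an undetermined crossing, called a precrossing. A precrossing is resolved by making it a positive or negative classical crossing (never a virtual crossing). The classicalizing number $\mathrm{cl}(S)$ is the minimum number of precrossings of $S$ that must be (suitably) resolved so that the result is necessarily classical, i.e. represents a classical knot regardless of how the remaining precrossings are resolved; $\mathrm{cl}(S)=\infty$ if no resolution of the precrossings gives a classical knot. Orient $S$. Smoothing a precrossing $c$ in accordance with the orientation produces two oriented components $L_1,L_2$. The intersection index $ind(c)$ is the virtual shadow linking number of $L_1$ and $L_2$: the sum, over all precrossings (not virtual crossings) between $L_1$ and $L_2$, of a sign which is $+1$ if $L_2$ crosses $L_1$ in one fixed direction (say from left to right) and $-1$ if it crosses in the other direction. Interchanging $L_1$ and $L_2$, or reversing the sign convention, only changes the overall sign of $ind(c)$. *)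

(* Defs.v *)
From HB Require Import structures.
From mathcomp Require Import all_boot all_order all_algebra.
From mathcomp Require Import all_classical.

Set Implicit Arguments.
Unset Strict Implicit.
Unset Printing Implicit Defensive.

Import GRing.Theory.
Local Open Scope nat_scope.

(* A generic closed curve is recorded by the cyclic sequence of passages       *)
(* through its double points, met while running once along an orientation.     *)
(* The passage (c, f) goes through the double point c, and f = true means that *)
(* there the other branch of the curve crosses from left to right.             *)
Definition passage := (nat * bool)%type.

Definition other (p : passage) : passage := (p.1, ~~ p.2).

Definition gauss_word (w : seq passage) : bool :=
  uniq w && all (fun p => other p \in w) w.

Definition double_points (w : seq passage) : seq nat := undup [seq p.1 | p <- w].

(* Combinatorial map of the curve. The dart (p, true) is the edge from p to    *)
(* the next passage, traversed forwards; (p, false) is the same edge traversed *)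
(* backwards.                                                                  *)
Definition darts (w : seq passage) : seq (passage * bool) :=
  [seq (p, b) | p <- w, b <- [:: true; false]].

(* Keep the region on the left: run along the dart, then turn left into the    *)
(* other branch at the passage q that is reached.                              *)
Definition turn_left (w : seq passage) (d : passage * bool) : passage * bool :=
  let q := if d.2 then next w d.1 else d.1 in
  if q.2 == d.2 then (prev w (other q), false) else (other q, true).

(* On a Gauss word turn_left maps darts to darts, so insubd never defaults.    *)
Definition face_next (w : seq passage) (d : seq_sub (darts w)) :
  seq_sub (darts w) := insubd d (turn_left w (val d)).

Definition nb_regions (w : seq passage) : nat :=
  fcard (@face_next w) {: seq_sub (darts w)}.

(* Euler characteristic 2 for the connected 4-valent map with N = size w / 2   *)
(* vertices, 2N edges: the number of regions is N + 2. The curve without       *)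
(* double points has no dart and is treated apart.                             *)
Definition planar (w : seq passage) : bool :=
  (w == [::]) || (nb_regions w == (size w)./2 + 2).

(* A combinatorial map on the sphere; the outer region of the plane is not     *)
(* marked, since pushing an edge across infinity is a detour move (an open     *)
(* edge contains no crossing).                                                 *)
Record plane_curve := PlaneCurve {
  word :> seq passage;
  _ : gauss_word word && planar word }.

Variant crossing := Virtual | Positive | Negative.

Record diagram := Diagram { curve :> plane_curve; kind : nat -> crossing }.

Section Moves.
Variable k : nat -> crossing.

Definition classical_crossing (c : nat) : bool :=
  if k c is Virtual then false else true.

(* At a positive crossing the under-branch crosses the over-branch from right  *)
(* to left.                                                                    *)
Definition over (p : passage) : bool :=
  match k p.1 with
  | Virtual => false
  | Positive => ~~ p.2
  | Negative => p.2
  end.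

Definition strand (d : bool) (p q : passage) : seq passage :=
  if d then [:: p; q] else [:: q; p].

Definition avoid (s w : seq passage) : seq passage :=
  [seq p <- w | p.1 \notin double_points s].

(* Elementary moves, on words taken up to rotation. In R2 and R3 the flags say *)
(* that the displayed edges bound a region; d (or d1, d2, d3) is true when the *)
(* strand runs along the boundary in the direction of the notation.            *)
Inductive move : seq passage -> seq passage -> Prop :=
| Reidemeister1 A c f :
    classical_crossing c ->
    move A (A ++ [:: (c, f); (c, ~~ f)])
| Reidemeister2 A B x y f d :
    let x1 := (x, f) in let y1 := (y, ~~ f) in
    over x1 && over y1 || over (other x1) && over (other y1) ->
    move (A ++ B) (A ++ [:: x1; y1] ++ B ++ strand d (other x1) (other y1))
(* Walking x, y, z around the triangle, one follows strand 1 from x to y,      *)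
(* strand 2 from y to z and strand 3 from z to x; the bit o tells on which     *)
(* side the triangle lies.                                                     *)
| Reidemeister3 A B C x y z o d1 d2 d3 :
    let y1 := (y, o (+) d1 (+) d2) in let y2 := other y1 in
    let z2 := (z, o (+) d2 (+) d3) in let z3 := other z2 in
    let x3 := (x, o (+) d3 (+) d1) in let x1 := other x3 in
    [&& classical_crossing x, classical_crossing y & classical_crossing z] ->
    [|| over x1 && over y1, over y2 && over z2 | over z3 && over x3] ->
    move (strand d1 x1 y1 ++ A ++ strand d2 y2 z2 ++ B ++ strand d3 z3 x3 ++ C)
         (strand (~~ d1) x1 y1 ++ A ++ strand (~~ d2) y2 z2 ++ B ++
          strand (~~ d3) z3 x3 ++ C)
(* The strand s is replaced by s'; erasing the crossings on the moving strand  *)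
(* leaves the same open arc, whose Gauss word determines it up to isotopy.     *)
| Detour A A' s s' :
    {in s ++ s', forall p, k p.1 = Virtual} ->
    avoid s A = avoid s' A' ->
    move (A ++ s) (A' ++ s').

End Moves.

(* Two records of one and the same unoriented diagram up to isotopy: the base  *)
(* point, the orientation and the names of the double points are immaterial.   *)
(* Reversing both branches at a crossing preserves its flags and its sign.     *)
Variant isotopic (D D' : diagram) : Prop :=
| Rebase n of word D' = rot n (word D) & kind D' =1 kind D
| Reverse of word D' = rev (word D) & kind D' =1 kind D
| Rename (f : nat -> nat) of
    {in double_points D &, injective f} &
    word D' = [seq (f p.1, p.2) | p <- word D] &
    {in double_points D, forall c, kind D' (f c) = kind D c}.

Inductive virtually_equivalent : diagram -> diagram -> Prop :=
| VIsotopic D D' : isotopic D D' -> virtually_equivalent D D'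
| VMove D D' : kind D' =1 kind D -> move (kind D) (word D) (word D') ->
    virtually_equivalent D D'
| VSym D D' : virtually_equivalent D D' -> virtually_equivalent D' D
| VTrans D D' D'' : virtually_equivalent D D' -> virtually_equivalent D' D'' ->
    virtually_equivalent D D''.

Definition is_classical (D : diagram) : Prop :=
  exists D' : diagram, virtually_equivalent D D' /\
    {in double_points D', forall c, kind D' c <> Virtual}.

Record shadow := Shadow { scurve :> plane_curve; is_virtual : pred nat }.

Definition precrossings (S : shadow) : seq nat :=
  [seq c <- double_points S | ~~ is_virtual S c].

(* r c is true when the precrossing c is made positive.                        *)
Definition resolve (S : shadow) (r : nat -> bool) : diagram :=
  Diagram S (fun c => if is_virtual S c then Virtual
                      else if r c then Positive else Negative).

Definition classicalizable_with (S : shadow) (n : nat) : Prop :=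
  exists P : seq nat,
    [/\ uniq P, {subset P <= precrossings S}, size P = n &
     exists r : nat -> bool, forall r' : nat -> bool,
       {in P, r' =1 r} -> is_classical (resolve S r')].

(* None stands for infinity. *)
Definition enat := option nat.

Definition enat_ge (e : enat) (n : nat) : Prop := if e is Some k then n <= k else True.

Definition cl (S : shadow) : enat :=
  match pselect (exists n, `[< classicalizable_with S n >]) with
  | left H => Some (ex_minn H)
  | right _ => None
  end.

Definition smoothing (w : seq passage) (c : nat) : seq passage * seq passage :=
  let at_c := fun p : passage => p.1 == c in
  let v := behead (rot (find at_c w) w) in
  (take (find at_c v) v, drop (find at_c v).+1 v).

Definition ind (S : shadow) (c : nat) : int :=
  let: (L1, L2) := smoothing S c in
  (\sum_(p <- L1 | (p.1 \in precrossings S) && (p.1 \in double_points L2))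
     (if p.2 then 1 else -1))%R.

Definition C_ (S : shadow) (m : int) : seq nat :=
  [seq c <- precrossings S | ind S c == m].

Lemma sum_size_C (S : shadow) :
  \big[addn/0]_(m \in [set m : int | m != 0%R]%classic) size (C_ S m)
  = size [seq c <- precrossings S | ind S c != 0%R].
Proof.
pose s := undup [seq ind S c | c <- precrossings S & ind S c != 0%R].
have us : uniq s by apply: undup_uniq.
have -> : \big[addn/0]_(m \in [set m : int | m != 0%R]%classic) size (C_ S m)
   = \sum_(m <- s) size (C_ S m).
  rewrite [RHS](fsbig_seq _ _ us); apply/esym; apply: fsbig_widen.
    move=> m /=; rewrite mem_undup => /mapP[c]; rewrite mem_filter.
    by move=> /andP[cn0 _] ->.
  move=> m /= [m0 ms]; apply/eqP; rewrite size_filter -leqn0 leqNgt -has_count.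
  apply/negP => /hasP[c cS /eqP cm]; apply: ms => /=.
  by rewrite mem_undup; apply/mapP; exists c; rewrite // mem_filter cm m0.
have memC c : c \in precrossings S -> ind S c != 0%R -> ind S c \in s.
  move=> cS c0; rewrite mem_undup; apply/mapP; exists c => //.
  by rewrite mem_filter c0.
have s0 : 0%R \notin s.
  rewrite mem_undup; apply/mapP => -[c]; rewrite mem_filter => /andP[+ _] e.
  by rewrite -e eqxx.
under eq_bigr do rewrite size_filter -sum1_count.
rewrite size_filter -sum1_count.
rewrite (exchange_big_dep xpredT) //= [RHS]big_mkcond /=.
rewrite [LHS]big_seq [RHS]big_seq; apply: eq_bigr => c cS.
rewrite (eq_bigl (pred1 (ind S c))); last by move=> m; rewrite /= eq_sym.
rewrite sum1_count count_uniq_mem //.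
have [c0|c0] := boolP (ind S c == 0%R); last by rewrite memC.
by rewrite (eqP c0) (negbTE s0).
Qed.

Lemma cl_infinite (S : shadow) :
  cl S = None <-> forall r, ~ is_classical (resolve S r).
Proof.
rewrite /cl; case: pselect => [H|H]; split => //.
  move=> noR; have [n /asboolP[P [_ _ _ [r Hr]]]] := H.
  by case: (noR r); exact: Hr.
move=> _ r clr; apply: H; exists (size (precrossings S)); apply/asboolP.
exists (precrossings S); split => //; [by rewrite filter_uniq // undup_uniq |].
exists r => r' rr'; have [D [eqD DV]] := clr; exists D; split => //.
apply: VTrans eqD; apply: VIsotopic; apply: (@Rename _ _ id) => //=.
  by rewrite -[LHS]map_id; apply: eq_map => -[].
move=> c cS; case: ifP => // /negbT cV.
by rewrite rr' // mem_filter cV.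
Qed.

(* Main.v *)
Require Import Defs.
From mathcomp Require Import all_boot all_order all_algebra.
From mathcomp Require Import all_classical.
From mathcomp Require Import zify ring lra.

Set Implicit Arguments.
Unset Strict Implicit.
Unset Printing Implicit Defensive.

Import GRing.Theory.
Local Open Scope ring_scope.

(* Weight each classical crossing by its sign when its index is nonzero and by
   0 otherwise: the resulting writhe does not change along virtual equivalence.
   It vanishes on classical diagrams, since the Alexander numbering of the
   regions forces every index to be 0. The index only depends on the shadow, so
   flipping a crossing of nonzero index changes this writhe: such a crossing
   cannot be left unresolved in a set which forces classicality. *)

(** The plain writhe changes under a first Reidemeister move; discarding the crossings of index 0
    repairs this, because a kink has index 0. Only the vanishing of an index matters, so its sign,
    which depends on the orientation and on the order of the two components, can be left loose. The
    index is read in the word from which all virtual passages are erased. A detour leaves that word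
    untouched, but the word may fail to be planar; invariance therefore rests on the pairing of
    passages alone, and planarity enters once, for a diagram without virtual crossings. There it is
    available only as a count of orbits, so the Alexander numbering has to be extracted from Euler's
    formula, by a rank count over the rationals. *)

Definition flag_sign (p : passage) : int := if p.2 then 1 else -1.

Definition flag_sum (s : seq passage) : int := \sum_(p <- s) flag_sign p.

(** On a planar curve this is, up to a constant, the Alexander number of the edge arriving at
    [p]. *)
Definition height (w : seq passage) (p : passage) : int :=
  flag_sum (take (index p w) w).

(* Up to sign, the sum of the flags strictly between the two passages of c,
   in whichever order these passages occur. *)
Definition chord_index (w : seq passage) (c : nat) : int :=
  height w (c, false) - height w (c, true) - 1.

Definition reduced (k : nat -> crossing) (w : seq passage) : seq passage :=
  [seq p <- w | classical_crossing k p.1].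

Definition crossing_sign (x : crossing) : int :=
  match x with Virtual => 0 | Positive => 1 | Negative => -1 end.

(** The sum runs over passages, so in a Gauss word each crossing counts twice. *)
Definition index_writhe (k : nat -> crossing) (v : seq passage) : int :=
  \sum_(p <- v | chord_index v p.1 != 0) crossing_sign (k p.1).

(** * Flag sums and heights in Gauss words *)

Lemma otherK : involutive other.
Proof. by case=> c b; rewrite /other /= negbK. Qed.

Lemma flag_sign_other p : flag_sign (other p) = - flag_sign p.
Proof. by case: p => c []. Qed.

Lemma flag_sum_nil : flag_sum [::] = 0.
Proof. exact: big_nil. Qed.

Lemma flag_sum_cons p s : flag_sum (p :: s) = flag_sign p + flag_sum s.
Proof. exact: big_cons. Qed.

Lemma flag_sum_cat s t : flag_sum (s ++ t) = flag_sum s + flag_sum t.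
Proof. exact: big_cat. Qed.

Lemma gauss_word_uniq w : gauss_word w -> uniq w.
Proof. by case/andP. Qed.

Lemma mem_other w p : gauss_word w -> (other p \in w) = (p \in w).
Proof.
case/andP=> _ /allP cl; apply/idP/idP=> [/cl|/cl //].
by rewrite otherK.
Qed.

Lemma mem_gauss w p : gauss_word w -> p \in w -> forall b, (p.1, b) \in w.
Proof.
case: p => c b gw pw b'; case: (eqVneq b b') => [<- //|].
move=> nb; have -> : (c, b') = other (c, b); last by rewrite mem_other.
by case: b b' nb {pw} => -[].
Qed.

Lemma flag_sum_gauss w : gauss_word w -> flag_sum w = 0.
Proof.
move=> gw; have uw := gauss_word_uniq gw.
have : flag_sum w = - flag_sum w.
  rewrite /flag_sum -sumrN.
  under [RHS]eq_bigr do rewrite -flag_sign_other.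
  rewrite -(big_map other xpredT flag_sign); apply: perm_big.
  rewrite uniq_perm ?map_inj_uniq //; first exact: inv_inj otherK.
  move=> p; apply/idP/mapP => [pw|[q qw ->]]; last by rewrite mem_other.
  by exists (other p); rewrite ?otherK ?mem_other.
by lia.
Qed.

Lemma gauss_word_filter (a : pred nat) w :
  gauss_word w -> gauss_word [seq p <- w | a p.1].
Proof.
move=> gw; rewrite /gauss_word filter_uniq ?gauss_word_uniq //=.
by apply/allP=> p; rewrite !mem_filter mem_other //= => /andP[-> ->].
Qed.

Lemma gauss_word_reduced k w : gauss_word w -> gauss_word (reduced k w).
Proof. exact: gauss_word_filter. Qed.

Lemma height_catl s t p : p \in s -> height (s ++ t) p = height s p.
Proof.
by move=> ps; rewrite /height index_cat ps takel_cat // ltnW ?index_mem.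
Qed.

Lemma height_catr s t p :
  p \notin s -> height (s ++ t) p = flag_sum s + height t p.
Proof.
move=> /negbTE ps; rewrite /height index_cat ps take_cat ltnNge leq_addr /=.
by rewrite addKn flag_sum_cat.
Qed.

Lemma height_cons q s p :
  height (q :: s) p = if q == p then 0 else flag_sign q + height s p.
Proof.
by rewrite /height /=; case: eqP => _; rewrite ?flag_sum_nil ?flag_sum_cons.
Qed.

Lemma height_catE s t p :
  height (s ++ t) p = if p \in s then height s p else flag_sum s + height t p.
Proof. by case: ifPn => [/height_catl|/height_catr]. Qed.

(** * Invariance under isotopy *)

Lemma index_writhe_perm k v v' : perm_eq v v' ->
  {in v, forall p, (chord_index v p.1 == 0) = (chord_index v' p.1 == 0)} ->
  index_writhe k v = index_writhe k v'.
Proof.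
move=> pv h; rewrite /index_writhe -(perm_big _ pv) /=.
rewrite big_seq_cond [RHS]big_seq_cond; apply: eq_bigl => p.
by case: (boolP (p \in v)) => // /h ->.
Qed.

(** The flags sum to 0 over the whole word, so moving the base point shifts all heights by one and
    the same constant. *)
Lemma chord_index_rot w n c : gauss_word w -> (c, true) \in w ->
  chord_index (rot n w) c = chord_index w c.
Proof.
rewrite /rot; move: (cat_take_drop n w).
move: (take n w) (drop n w) => A B <- gw ct.
have cf : (c, false) \in A ++ B by exact: (mem_gauss gw ct).
have := flag_sum_gauss gw; have := gauss_word_uniq gw.
rewrite cat_uniq flag_sum_cat => /and3P[_ /hasPn dis _] tot.
have sh p : p \in A ++ B ->
  height (B ++ A) p = height (A ++ B) p - flag_sum A.
  rewrite mem_cat !height_catE.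
  case: (boolP (p \in B)) => [/dis/negbTE -> _|_]; first by lia.
  by rewrite orbF => ->; lia.
by rewrite /chord_index !sh //; lia.
Qed.

(** What precedes [p] in [rev w] is what follows it in [w], and the total flag sum is 0. *)
Lemma chord_index_rev w c : gauss_word w -> (c, true) \in w ->
  chord_index (rev w) c = - chord_index w c.
Proof.
move=> gw ct; have cf : (c, false) \in w by exact: (mem_gauss gw ct).
have tot := flag_sum_gauss gw; have uw := gauss_word_uniq gw.
have sh p : p \in w -> height (rev w) p = - height w p - flag_sign p.
  move=> pw; move: tot uw; case: (path.splitPr pw) => A B.
  rewrite flag_sum_cat flag_sum_cons cat_uniq /= => tot.
  case/and3P=> _; rewrite negb_or => /andP[pA _] /andP[pB _].
  rewrite rev_cat rev_cons cat_rcons !height_catr ?mem_rev //.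
  have -> : flag_sum (rev B) = flag_sum B by apply: perm_big; rewrite perm_rev.
  by rewrite !height_cons eqxx; lia.
by rewrite /chord_index !sh //= /flag_sign /=; lia.
Qed.

Lemma height_map (f : passage -> passage) w p :
  {in w &, injective f} -> (forall q, flag_sign (f q) = flag_sign q) ->
  p \in w -> height (map f w) (f p) = height w p.
Proof.
move=> + fs; elim: w => //= q w IH inj; rewrite inE (eq_sym p) !height_cons fs.
case: (eqVneq q p) => [->|nqp]; first by rewrite eqxx.
move=> /= pw; case: eqP => [/inj|_].
  by rewrite !inE eqxx pw orbT => /(_ isT isT)/eqP; rewrite (negbTE nqp).
by rewrite IH // => x y xw yw; apply: inj; rewrite inE ?xw ?yw orbT.
Qed.

Lemma gauss_word_curve (K : plane_curve) : gauss_word K.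
Proof. by case: K => w /= /andP[]. Qed.

Lemma mem_double_points w p : p \in w -> p.1 \in double_points w.
Proof. by move=> pw; rewrite mem_undup map_f. Qed.

Definition diagram_writhe (D : diagram) : int :=
  index_writhe (kind D) (reduced (kind D) D).

Lemma reduced_cat k s t : reduced k (s ++ t) = reduced k s ++ reduced k t.
Proof. exact: filter_cat. Qed.

Lemma chord_index_map f v c : {in v &, forall p q, f p.1 = f q.1 -> p.1 = q.1} ->
  gauss_word v -> (c, true) \in v ->
  chord_index [seq (f p.1, p.2) | p <- v] (f c) = chord_index v c.
Proof.
move=> inj gv ct; have cf : (c, false) \in v by exact: (mem_gauss gv ct).
have injg : {in v &, injective (fun p : passage => (f p.1, p.2))}.
  by move=> [a s] [b t] av bv [] e <-; have /= -> := inj _ _ av bv e.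
by rewrite /chord_index -!(height_map injg).
Qed.

Lemma index_writhe_isotopic D D' :
  isotopic D D' -> diagram_writhe D' = diagram_writhe D.
Proof.
have gD := gauss_word_curve D; have gv := gauss_word_reduced (kind D) gD.
case=> [n ew|ew|f inj ew ek]; rewrite /diagram_writhe.
- move=> /funext ->; rewrite ew; set v := reduced _ D in gv *.
  have [m ->] : exists m, reduced (kind D) (rot n D) = rot m v.
    (* Erasing virtual passages turns a rotation by [n] into a rotation by the number of classical
       passages among the first [n]. *)
    exists (size (reduced (kind D) (take n D))).
    rewrite /v -[in X in _ = rot _ X](cat_take_drop n D) !reduced_cat.
    by rewrite rot_size_cat.
  apply: index_writhe_perm; first by rewrite perm_rot.
  move=> p; rewrite mem_rot => /(mem_gauss gv) pv.
  by rewrite chord_index_rot.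
- move=> /funext ->; rewrite ew /reduced filter_rev -/(reduced _ _).
  apply: index_writhe_perm; first by rewrite perm_rev.
  move=> p; rewrite mem_rev => /(mem_gauss gv) pv.
  by rewrite chord_index_rev // oppr_eq0.
have -> : reduced (kind D') D' = [seq (f p.1, p.2) | p <- reduced (kind D) D].
  rewrite ew /reduced filter_map; congr map; apply: eq_in_filter => p pD /=.
  by rewrite /classical_crossing ek // mem_double_points.
have sub p : p \in reduced (kind D) D -> p.1 \in double_points D.
  by rewrite mem_filter => /andP[_]; exact: mem_double_points.
rewrite /index_writhe big_map big_seq_cond [RHS]big_seq_cond.
apply: eq_big => [p|p /andP[/sub pD _]] /=; last by rewrite ek.
case: (boolP (p \in _)) => //= pv.
rewrite chord_index_map //; first by move=> q r /sub qD /sub rD; apply: inj.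
exact: (mem_gauss gv pv).
Qed.

(** * Invariance under the Reidemeister moves *)

Lemma index_writhe_R1 k A c f : gauss_word A ->
  gauss_word (A ++ [:: (c, f); (c, ~~ f)]) ->
  index_writhe k (A ++ [:: (c, f); (c, ~~ f)]) = index_writhe k A.
Proof.
move=> gA /gauss_word_uniq; rewrite cat_uniq /= orbF negb_or.
case/and3P=> _ /andP[cA c'A] _; rewrite /index_writhe big_cat /=.
have {cA c'A}nc b : (c, b) \notin A by case: f b cA c'A => -[].
have e : chord_index (A ++ [:: (c, f); (c, ~~ f)]) c = 0.
  rewrite /chord_index !height_catr // !height_cons !xpair_eqE eqxx /=.
  by case: f; rewrite /= /flag_sign /=; lia.
rewrite !big_cons big_nil /= e eqxx addr0.
rewrite big_seq_cond [RHS]big_seq_cond; apply: eq_bigl => p.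
case: (boolP (p \in A)) => //= /(mem_gauss gA) pA.
by rewrite /chord_index !height_catl.
Qed.

(** [over] is false at virtual crossings, and where one strand is over at both crossings, its
    opposite flags there force opposite signs. *)
Lemma over_pair k x y f :
  let x1 : passage := (x, f) in let y1 : passage := (y, ~~ f) in
  Defs.over k x1 && Defs.over k y1 ||
    Defs.over k (other x1) && Defs.over k (other y1) ->
  [/\ classical_crossing k x, classical_crossing k y &
      crossing_sign (k y) = - crossing_sign (k x)].
Proof.
by rewrite /= /Defs.over /classical_crossing /=; case: (k x); case: (k y); case: f.
Qed.

Lemma notin_passages (s : seq passage) c b :
  (c, b) \notin s -> (c, ~~ b) \notin s -> forall b', ((c, b') \in s) = false.
Proof. by move=> n1 n2 b'; apply/negbTE; case: b b' n1 n2 => -[]. Qed.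

Lemma notin_passages_cat (s t : seq passage) c :
  (forall b, ((c, b) \in s ++ t) = false) ->
  (forall b, ((c, b) \in s) = false) /\ (forall b, ((c, b) \in t) = false).
Proof.
by move=> n; split=> b; have := n b; rewrite mem_cat => /norP[/negbTE + /negbTE].
Qed.

Lemma index_writhe_R2 k A B x y f d :
  let x1 : passage := (x, f) in let y1 : passage := (y, ~~ f) in
  let v := A ++ [:: x1; y1] ++ B ++ strand d (other x1) (other y1) in
  crossing_sign (k y) = - crossing_sign (k x) ->
  gauss_word (A ++ B) -> gauss_word v ->
  index_writhe k v = index_writhe k (A ++ B).
Proof.
move=> x1 y1 v kyx gAB gv.
have pv : perm_eq v ((A ++ B) ++ [:: x1; y1; other x1; other y1]).
  rewrite /v -catA perm_cat2l perm_catCA perm_cat2l.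
  rewrite (perm_cat2l [:: x1; y1] _ [:: other x1; other y1]).
  by case: (d); rewrite //= (perm_catC [:: _] [:: _]).
have := gauss_word_uniq gv; rewrite (perm_uniq pv) cat_uniq /= !orbF !negb_or.
case/and3P=> _ /and4P[n1 n2 n3 n4] dis.
have nxy : (x == y) = false.
  by apply/eqP=> e; move: dis; rewrite /x1 /y1 /other e !xpair_eqE eqxx /=; case: (f).
have nx := notin_passages n1 n3; have ny := notin_passages n2 n4.
have [nxA nxB] := notin_passages_cat nx.
have [nyA nyB] := notin_passages_cat ny.
have tot := flag_sum_gauss gAB; rewrite flag_sum_cat in tot.
(* The two chords enclose equal flag sums: both contain [B], and the further flags of the bigon
   either agree or cancel, according to [d]. Since [x1] and [y1] have opposite flags, the two
   indices are opposite. *)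
have exy : (chord_index v y == 0) = (chord_index v x == 0).
  rewrite /chord_index /v /x1 /y1 !height_catE !nxA !nyA.
  by case: (f) (d) => -[]; rewrite ?height_catE ?height_cons ?inE ?nxB ?nyB;
    rewrite ?xpair_eqE /= ?eqxx ?(eq_sym y) ?nxy /= ?flag_sum_cons ?flag_sum_nil;
    rewrite /flag_sign /=; move: tot; clear; move=> tot; apply/eqP/eqP; lia.
rewrite /index_writhe (perm_big _ pv) big_cat !big_cons big_nil /= kyx exy.
rewrite [X in _ + X](_ : _ = 0); last first.
  by case: (chord_index v x == 0) => /=; clear; lia.
rewrite addr0 big_seq_cond [RHS]big_seq_cond; apply: eq_bigl => p.
case: (boolP (p \in A ++ B)) => //= /(mem_gauss gAB) pAB.
(* The flags of [x1] and [y1] cancel, so their insertion does not shift the heights in [B]. *)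
suff h b : height v (p.1, b) = height (A ++ B) (p.1, b) by rewrite /chord_index !h.
have px : (p.1 == x) = false by apply/eqP=> e; have := pAB true; rewrite e nx.
have py : (p.1 == y) = false by apply/eqP=> e; have := pAB true; rewrite e ny.
have := pAB b; rewrite /v mem_cat !height_catE !inE !xpair_eqE px py /=.
case: (_ \in A) => //= ->; rewrite !flag_sum_cons flag_sum_nil /flag_sign /=.
by case: (f) => /=; clear; lia.
Qed.

Lemma other_neq p : (p == other p) = false.
Proof. by case: p => c b; rewrite xpair_eqE eqxx; case: b. Qed.

Lemma mem_strand d p q r : (p \in strand d q r) = (p == q) || (p == r).
Proof. by case: d; rewrite !inE // orbC. Qed.

Lemma flag_sum_strand d q r : flag_sum (strand d q r) = flag_sign q + flag_sign r.
Proof. by case: d; rewrite !flag_sum_cons flag_sum_nil addr0 // addrC. Qed.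

Lemma count_strand a d q r : count a (strand d q r) = (a q + a r)%N.
Proof. by case: d; rewrite /= addn0 // addnC. Qed.

Lemma height_strand_fst d q r : (r == q) = false ->
  height (strand d q r) q = if d then 0 else flag_sign r.
Proof. by move=> n; case: d; rewrite !height_cons ?n eqxx ?addr0. Qed.

Lemma height_strand_snd d q r : (q == r) = false ->
  height (strand d q r) r = if d then flag_sign q else 0.
Proof. by move=> n; case: d; rewrite !height_cons ?n eqxx ?addr0. Qed.

Lemma chord_index_passage w p :
  chord_index w p.1 = flag_sign p * (height w (other p) - height w p) - 1.
Proof.
by case: p => c []; rewrite /chord_index /flag_sign /other /= ?mul1r ?mulN1r ?opprB.
Qed.

(** Both passages of a corner of the triangle shift in height by the same amount: reading bits as
    signs, it is the product of the sign of [o] and the sign of the direction [d] of the strand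
    opposite that corner. All other heights stay, because the flag sum of a strand does not depend
    on its order. The switch [e] lets both sides of the move share one formula. *)
Lemma index_writhe_R3 k A B C x y z o d1 d2 d3 :
  let y1 : passage := (y, o (+) d1 (+) d2) in let y2 := other y1 in
  let z2 : passage := (z, o (+) d2 (+) d3) in let z3 := other z2 in
  let x3 : passage := (x, o (+) d3 (+) d1) in let x1 := other x3 in
  let v e := strand (e (+) d1) x1 y1 ++ A ++ strand (e (+) d2) y2 z2 ++ B ++
          strand (e (+) d3) z3 x3 ++ C in
  gauss_word (v false) ->
  index_writhe k (v true) = index_writhe k (v false).
Proof.
move=> y1 y2 z2 z3 x3 x1 v gv.
have pv e : perm_eq (v e) ((A ++ B ++ C) ++ [:: x1; x3; y1; y2; z2; z3]).
  by apply/permP=> a; rewrite /v !(count_cat, count_strand) /=; clear; lia.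
have pvv : perm_eq (v true) (v false) by rewrite (perm_trans (pv _)) // perm_sym.
have := gauss_word_uniq gv; rewrite (perm_uniq (pv false)) cat_uniq /= orbF.
case/and3P=> _; rewrite !negb_or => /and5P[m1 m2 m3 m4 /andP[m5 m6]] dis.
have nxy : (x == y) = false.
  apply/eqP=> e; move: dis; rewrite /x1 /y2 /y1 /x3 /other e !xpair_eqE eqxx /=.
  by case: (o (+) d1 (+) d2) (o (+) d3 (+) d1) => -[].
have nxz : (x == z) = false.
  apply/eqP=> e; move: dis; rewrite /x1 /z3 /z2 /x3 /other e !xpair_eqE eqxx /=.
  by case: (o (+) d2 (+) d3) (o (+) d3 (+) d1) => -[]; rewrite ?orbT ?andbF.
have nyz : (y == z) = false.
  apply/eqP=> e; move: dis; rewrite /y2 /z3 /z2 /y1 /other e !xpair_eqE eqxx /=.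
  by case: (o (+) d2 (+) d3) (o (+) d1 (+) d2) => -[]; rewrite ?orbT ?andbF.
have [nxA] := notin_passages_cat (notin_passages m2 m1).
case/notin_passages_cat=> nxB nxC.
have [nyA] := notin_passages_cat (notin_passages m3 m4).
case/notin_passages_cat=> nyB nyC.
have [nzA] := notin_passages_cat (notin_passages m5 m6).
case/notin_passages_cat=> nzB nzC.
have [nyx nzx nzy] : [/\ (y == x) = false, (z == x) = false & (z == y) = false].
  by rewrite !(eq_sym z) eq_sym.
pose S1 := flag_sign x1 + flag_sign y1; pose S2 := flag_sign y2 + flag_sign z2.
have Hx1 e : height (v e) x1 = if e (+) d1 then 0 else flag_sign y1.
  rewrite /v height_catl ?mem_strand ?eqxx //.
  by rewrite height_strand_fst // xpair_eqE nyx.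
have Hx3 e : height (v e) x3 =
    S1 + (flag_sum A + (S2 + (flag_sum B + if e (+) d3 then flag_sign z3 else 0))).
  do 4!rewrite height_catr ?mem_strand ?other_neq ?xpair_eqE ?nxy ?nxz ?nxA ?nxB //.
  rewrite height_catl ?mem_strand ?eqxx ?orbT // !flag_sum_strand.
  by rewrite height_strand_snd // xpair_eqE nzx.
have Hy1 e : height (v e) y1 = if e (+) d1 then flag_sign x1 else 0.
  rewrite /v height_catl ?mem_strand ?eqxx ?orbT //.
  by rewrite height_strand_snd // xpair_eqE nxy.
have Hy2 e : height (v e) y2 =
    S1 + (flag_sum A + if e (+) d2 then 0 else flag_sign z2).
  do 2!rewrite height_catr ?mem_strand ?(eq_sym y2) ?other_neq ?xpair_eqE ?nxy ?nyA //.
  rewrite height_catl ?mem_strand ?eqxx // flag_sum_strand.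
  by rewrite height_strand_fst // xpair_eqE nzy.
have Hz2 e : height (v e) z2 =
    S1 + (flag_sum A + if e (+) d2 then flag_sign y2 else 0).
  do 2!rewrite height_catr ?mem_strand ?xpair_eqE ?nzx ?nzy ?nzA //.
  rewrite height_catl ?mem_strand ?eqxx ?orbT // flag_sum_strand.
  by rewrite height_strand_snd // xpair_eqE nyz.
have Hz3 e : height (v e) z3 =
    S1 + (flag_sum A + (S2 + (flag_sum B + if e (+) d3 then 0 else flag_sign x3))).
  do 4!rewrite height_catr ?mem_strand ?(eq_sym z3) ?other_neq ?xpair_eqE ?nxz
    ?nyz ?nzA ?nzB //.
  rewrite height_catl ?mem_strand ?eqxx // !flag_sum_strand.
  by rewrite height_strand_fst // xpair_eqE nxz.
have Jx : chord_index (v true) x = chord_index (v false) x.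
  rewrite !(chord_index_passage _ x1) otherK !Hx1 !Hx3 /flag_sign /=; clear.
  by case: (o) (d1) (d2) (d3) => -[] [] [] /=; lia.
have Jy : chord_index (v true) y = chord_index (v false) y.
  rewrite !(chord_index_passage _ y1) !Hy1 !Hy2 /flag_sign /=; clear.
  by case: (o) (d1) (d2) (d3) => -[] [] [] /=; lia.
have Jz : chord_index (v true) z = chord_index (v false) z.
  rewrite !(chord_index_passage _ z2) !Hz2 !Hz3 /flag_sign /=; clear.
  by case: (o) (d1) (d2) (d3) => -[] [] [] /=; lia.
apply: index_writhe_perm => // p; rewrite (perm_mem pvv).
move=> /(mem_gauss gv) pv0.
case: (eqVneq p.1 x) => [->|/negbTE px]; first by rewrite Jx.
case: (eqVneq p.1 y) => [->|/negbTE py]; first by rewrite Jy.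
case: (eqVneq p.1 z) => [->|/negbTE pz]; first by rewrite Jz.
suff h b : height (v true) (p.1, b) = height (v false) (p.1, b).
  by rewrite /chord_index !h.
by rewrite /v !height_catE !mem_strand !xpair_eqE px py pz /= !flag_sum_strand.
Qed.

(** * Detours and virtual equivalence *)

Lemma reduced_strand k d p q :
  classical_crossing k p.1 -> classical_crossing k q.1 ->
  reduced k (strand d p q) = strand d p q.
Proof. by move=> kp kq; case: d; rewrite /reduced /= kp kq. Qed.

Lemma reduced_avoid k s A : {in s, forall p, k p.1 = Virtual} ->
  reduced k (A ++ s) = reduced k (avoid s A).
Proof.
move=> sV; rewrite reduced_cat [reduced k s](_ : _ = [::]) ?cats0.
  rewrite /reduced /avoid -filter_predI; apply: eq_filter => p /=.
  case: (boolP (p.1 \in _)); rewrite /= ?andbT ?andbF // mem_undup.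
  by case/mapP=> q /sV qV ->; rewrite /classical_crossing qV.
rewrite -(filter_pred0 s); apply: eq_in_filter => p /sV.
by rewrite /classical_crossing => ->.
Qed.

Lemma index_writhe_move k w w' : gauss_word w -> gauss_word w' ->
  move k w w' -> index_writhe k (reduced k w') = index_writhe k (reduced k w).
Proof.
move=> gw gw' mv; move: (gauss_word_reduced k gw) (gauss_word_reduced k gw').
case: mv => {w w' gw gw'} [A c f kc|A B x y f d x1 y1 /over_pair[kx ky kxy]|
  A B C x y z o d1 d2 d3 y1 y2 z2 z3 x3 x1 /and3P[kx ky kz] _|A A' s s' sV e].
- rewrite reduced_cat [reduced k [:: _; _]]/= /reduced /= kc => gA gv.
  exact: index_writhe_R1.
- rewrite !reduced_cat reduced_strand // [reduced k [:: _; _]]/reduced /= kx ky.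
  by move=> gAB gv; exact: index_writhe_R2.
- rewrite !reduced_cat !reduced_strand // => gv _.
  exact: (@index_writhe_R3 k _ _ _ x y z o d1 d2 d3).
by rewrite !reduced_avoid ?e // => p ps; apply: sV; rewrite mem_cat ps ?orbT.
Qed.

Lemma diagram_writhe_invariant D D' :
  virtually_equivalent D D' -> diagram_writhe D' = diagram_writhe D.
Proof.
elim=> {D D'} [D D'|D D' /funext e mv|D D' _ -> //|D D' D'' _ <- _ -> //].
  exact: index_writhe_isotopic.
by rewrite /diagram_writhe e; apply: index_writhe_move mv; exact: gauss_word_curve.
Qed.

(** * The intersection index of a smoothing *)

Lemma smoothingP w c : gauss_word w -> c \in double_points w ->
  exists A p M B, [/\ w = A ++ p :: M ++ other p :: B, p.1 = c,
    forall b, ((c, b) \in A ++ M ++ B) = false & smoothing w c = (M, B ++ A)].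
Proof.
move=> gw; rewrite mem_undup => /mapP[q qw ec].
pose at_c := fun p : passage => p.1 == c.
have hc : has at_c w by apply/hasP; exists q; rewrite // /at_c ec.
move: gw {q qw ec}; rewrite /smoothing -/at_c.
case: (split_find hc) => p A s pc nA gw.
have uw := gauss_word_uniq gw.
have os : other p \in s.
  have : other p \in rcons A p ++ s by rewrite mem_other // mem_cat mem_rcons mem_head.
  rewrite mem_cat mem_rcons inE eq_sym other_neq /= => /orP[oA|//].
  by case/hasP: nA; exists (other p).
case: (path.splitPr os) uw => M B uw {os}; exists A, p, M, B.
rewrite cat_rcons in uw *; have nc b : ((c, b) \in A ++ M ++ B) = false.
  have : uniq ([:: p; other p] ++ (A ++ M ++ B)).
    rewrite -(perm_uniq (s1 := A ++ p :: M ++ other p :: B)) //.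
    by apply/permP=> a; rewrite /= !count_cat /= !count_cat /=; clear; lia.
  rewrite cat_uniq => /and3P[_ /hasPn nc _]; apply/negP=> /nc.
  move/eqP: pc => <-; rewrite !inE.
  by case: (p) b => ? [] []; rewrite /other !xpair_eqE !eqxx.
have nM : ~~ has at_c M.
  apply/hasPn=> -[d b] qM; apply/eqP=> /= e; have := nc b.
  by rewrite -e !mem_cat qM orbT.
have fA : find at_c (A ++ p :: M ++ other p :: B) = size A.
  by rewrite find_cat (negbTE nA) /= pc addn0.
split=> //; first exact/eqP.
rewrite fA rot_size_cat /= -catA find_cat (negbTE nM) /= [at_c (other p)]pc addn0.
rewrite take_size_cat // -cat_rcons drop_size_cat ?size_rcons //.
Qed.

(** Self-crossings of the component [M] contribute both of their passages, whose flags cancel. *)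
Lemma flag_sum_closed (M : seq passage) (a : pred nat) : uniq M ->
  \sum_(q <- M | a q.1 && (other q \in M)) flag_sign q = 0.
Proof.
move=> uM; rewrite -big_filter; apply: flag_sum_gauss.
rewrite /gauss_word filter_uniq //=; apply/allP=> q.
by rewrite !mem_filter otherK => /andP[/andP[-> ->] ->].
Qed.

(** The linking sum runs over the passages of [M] shared with the other component. Adding the
    self-crossings of [M] changes nothing, and the result is the sum of all precrossing flags
    between the two passages of [c], which is the chord index up to sign. *)
Lemma ind_chord_index (S : shadow) c : c \in precrossings S -> ind S c != 0 ->
  chord_index [seq p <- word S | ~~ is_virtual S p.1] c != 0.
Proof.
rewrite mem_filter => /andP[cV cS].
have gS := gauss_word_curve S; have uS := gauss_word_uniq gS.
have [A [p [M [B [ew ec nc es]]]]] := smoothingP gS cS.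
have prec q : q \in word S -> (q.1 \in precrossings S) = ~~ is_virtual S q.1.
  by move=> qS; rewrite mem_filter mem_double_points ?andbT.
rewrite /ind es.
have pS : p \in word S by rewrite ew mem_cat mem_head orbT.
have sM q : q \in M -> q \in word S.
  by move=> qM; rewrite ew mem_cat inE mem_cat qM !orbT.
have /and3P[uM /hasPn dis _] : [&& uniq M, ~~ has (mem M) (B ++ A) & uniq (B ++ A)].
  have : uniq ([:: p; other p] ++ (M ++ (B ++ A))).
    rewrite -(perm_uniq (s1 := word S)) // ew.
    by apply/permP=> a; rewrite /= !count_cat /= !count_cat /=; clear; lia.
  by rewrite cat_uniq => /and3P[_ _]; rewrite cat_uniq.
have cross q : q \in M -> (q.1 \in double_points (B ++ A)) = (other q \notin M).
  move=> qM; apply/idP/idP.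
    rewrite mem_undup => /mapP[r rBA e]; apply/negP=> oM.
    have : r = q \/ r = other q.
      case: q r e {qM oM rBA} => [a b] [a' b'] /= ->.
      by case: b b' => -[]; do [by left | by right].
    by move=> er; case/negP: (dis _ rBA); case: er => ->.
  move=> oM; rewrite -[q.1]/((other q).1); apply: mem_double_points.
  have : other q \in word S by rewrite mem_other // sM.
  rewrite ew !(mem_cat, inE) (negbTE oM) /=.
  have nq : q.1 != c.
    apply/eqP=> e; have := nc q.2.
    by rewrite -e -surjective_pairing !mem_cat qM orbT.
  by case: q nq {qM oM} => a b /= nq; rewrite -ec in nq; case: (p) nq => a' b' /= nq;
   rewrite /other /= !xpair_eqE (negbTE nq) /= orbC.
have -> : \sum_(q <- M | (q.1 \in precrossings S) && (q.1 \in double_points (B ++ A)))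
    (if q.2 then 1 else -1) = \sum_(q <- M | ~~ is_virtual S q.1) flag_sign q.
  rewrite [RHS](bigID (fun q => other q \in M)) /=.
  rewrite (flag_sum_closed (fun a => ~~ is_virtual S a)) //.
  rewrite add0r big_seq_cond [RHS]big_seq_cond; apply: eq_bigl => r.
  by case: (boolP (r \in M)) => //= rM; rewrite prec ?sM // cross.
rewrite -big_filter -/(flag_sum _) -ec (chord_index_passage _ p) ew.
rewrite !filter_cat /= !filter_cat /=.
have [ncA] := notin_passages_cat nc; case/notin_passages_cat=> ncM _.
have np (X : seq passage) q : (forall b, ((c, b) \in X) = false) -> q.1 = c ->
    q \notin [seq r <- X | ~~ is_virtual S r.1].
  by move=> ncX qc; rewrite mem_filter [q]surjective_pairing qc ncX andbF.
rewrite ec cV !(height_catr _ (np _ _ ncA _)) // !height_cons other_neq.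
rewrite (height_catr _ (np _ _ ncM _)) // height_cons !eqxx !addr0.
move: (flag_sum _) (flag_sum _) => a b; apply: contra_neq.
by case: (p) => ? [] /=; rewrite /flag_sign /= ?mulN1r; clear; lia.
Qed.

(** * Regions of a curve and their connectedness *)

Lemma mem_darts w p b : ((p, b) \in darts w) = (p \in w).
Proof.
apply/allpairsP/idP => [[[q b'] [/= qw _ [-> _]]] // | pw].
by exists (p, b); split=> //; case: b.
Qed.

Lemma mem_turn_left w d : gauss_word w ->
  d \in darts w -> turn_left w d \in darts w.
Proof.
case: d => p b gw; rewrite mem_darts /turn_left /= => pw.
by case: ifP => _; rewrite mem_darts ?mem_prev mem_other //; case: b; rewrite ?mem_next.
Qed.

(** The direction bit of the image reveals which case was taken, hence the passage [q] reached; the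
    flag of [q] then gives back the direction of the dart, and so the dart. *)
Lemma turn_left_inj w : gauss_word w -> {in darts w &, injective (turn_left w)}.
Proof.
move=> gw; have uw := gauss_word_uniq gw.
move=> [p b] [q b']; rewrite !mem_darts /turn_left /= => pw qw.
pose tgt (p : passage) (b : bool) := if b then next w p else p.
have tgt_inj r s a : tgt r a = tgt s a -> r = s.
  by case: a => //= /(can_inj (prev_next uw)).
rewrite -/(tgt p b) -/(tgt q b').
case: (eqVneq (tgt p b).2) => [eb|nb]; case: (eqVneq (tgt q b').2) => [eb'|nb'] //;
  move/(congr1 fst)=> /=.
  move/(can_inj (next_prev uw))/(inv_inj otherK) => e.
  have ebb : b = b' by rewrite -eb -eb' e.
  by rewrite ebb in e *; rewrite (tgt_inj _ _ _ e).
move/(inv_inj otherK) => e; have ebb : b = b'.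
  by move: nb nb'; rewrite e; move: (tgt q b').2 => z {e}; case: z b b' => -[] [].
by rewrite ebb in e *; rewrite (tgt_inj _ _ _ e).
Qed.

Lemma face_nextE w (d : seq_sub (darts w)) : gauss_word w ->
  val (face_next d) = turn_left w (val d).
Proof. by move=> gw; rewrite insubdK // mem_turn_left // (valP d). Qed.

(** Numbering the orbits of [face_next] by ordinals lets regions index the rows of a matrix. *)
Lemma region_labelling w : gauss_word w -> w != [::] ->
  exists fi : passage * bool -> 'I_(nb_regions w),
    {in darts w, forall d, fi (turn_left w d) = fi d} /\
    forall i, exists2 d, d \in darts w & fi d = i.
Proof.
move=> gw w0; have [p pw] : exists p, p \in w.
  by case: (w) w0 => // p s _; exists p; rewrite mem_head.
have pd : (p, true) \in darts w by rewrite mem_darts.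
pose d0 : seq_sub (darts w) := SeqSub pd.
have inj : injective (@face_next w).
  move=> d d' /(congr1 val); rewrite !face_nextE // => /turn_left_inj.
  by move=> /(_ gw (valP d) (valP d'))/val_inj.
have sym := fconnect_sym inj.
pose A := [predI roots (frel (@face_next w)) & {: seq_sub (darts w)}].
have rA d : froot (@face_next w) d \in A by rewrite !inE (roots_root sym).
have rootS d : froot (@face_next w) (face_next d) = froot (@face_next w) d.
  by apply/eqP; rewrite (root_connect sym) sym; exact: fconnect1.
exists (fun d => enum_rank_in (rA d0) (froot (@face_next w) (insubd d0 d))); split.
  move=> d dw; have -> : insubd d0 (turn_left w d) = face_next (insubd d0 d).
    by apply: val_inj; rewrite face_nextE // !insubdK // mem_turn_left.
  by rewrite rootS.
move=> i; exists (val (enum_val i)); first exact: valP.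
have := enum_valP i; rewrite !inE andbT => /eqP.
by rewrite valKd => ->; rewrite enum_valK_in.
Qed.

(* Each corner of the crossing c is seen from the two edges which bound it. *)
Lemma corners w (T : Type) (chi : passage * bool -> T) c :
  gauss_word w -> {in darts w, forall d, chi (turn_left w d) = chi d} ->
  (c, true) \in w ->
  let t := (c, true) in let f := (c, false) in
  [/\ chi (prev w t, true) = chi (prev w f, false),
      chi (prev w f, true) = chi (t, true),
      chi (f, false) = chi (prev w t, false) &
      chi (t, false) = chi (f, true)].
Proof.
move=> gw inv tw t f; have fw : f \in w by exact: (mem_gauss gw tw).
have uw := gauss_word_uniq gw.
have inv' p b : p \in w -> chi (turn_left w (p, b)) = chi (p, b).
  by move=> pw; apply: inv; rewrite mem_darts.
split; symmetry.
- by rewrite -(inv' (prev w t) true) ?mem_prev // /turn_left /= next_prev.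
- by rewrite -(inv' (prev w f) true) ?mem_prev // /turn_left /= next_prev.
- by rewrite -(inv' f false).
- by rewrite -(inv' t false).
Qed.

Lemma next_constant w (T : Type) (g : passage -> T) : uniq w ->
  {in w, forall p, g (next w p) = g p} -> {in w &, forall p q, g p = g q}.
Proof.
move=> uw inv p q pw qw.
suff [p0 cst] : exists p0, {in w, forall q, g q = g p0} by rewrite !cst.
case ew : w pw => [//|y s] _; exists y => q0.
have : fpath (next w) y s.
  by have := cycle_next uw; rewrite ew /= rcons_path => /andP[].
have : {subset y :: s <= w} by rewrite ew.
elim: s y {ew} => [|z s IH] y sub; first by rewrite inE => _ /eqP ->.
case/andP=> /eqP e sz; rewrite inE => /orP[/eqP -> //|qs].
rewrite (IH z) // => [|r rs]; last by apply: sub; rewrite inE rs orbT.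
by rewrite -e inv // sub ?mem_head.
Qed.

(** Once the two sides of each edge agree, the corners at a crossing link every incoming edge to its
    outgoing one, and the single closed curve runs through all edges. *)
Lemma regions_connected w (T : Type) (chi : passage * bool -> T) :
  gauss_word w -> {in darts w, forall d, chi (turn_left w d) = chi d} ->
  {in w, forall p, chi (p, true) = chi (p, false)} ->
  {in darts w &, forall d d', chi d = chi d'}.
Proof.
move=> gw inv flip; have uw := gauss_word_uniq gw.
have cst : {in w &, forall p q, chi (p, true) = chi (q, true)}.
  apply: (next_constant uw) => p pw; rewrite -{2}[p](prev_next uw).
  have := mem_next w p; rewrite pw; move: (next w p) => q qw.
  have [] := corners gw inv (mem_gauss gw qw true).
  rewrite -!flip ?mem_prev ?(mem_gauss gw qw) //.
  by case: q qw => c [] /= _ e1 e2 e3 _; rewrite ?e3 e1 ?e2.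
by case=> p b [q b']; rewrite !mem_darts => pw qw; case: b b' => -[];
  rewrite -?flip //; apply: cst.
Qed.

(** * Alexander numbering and vanishing of the index on planar curves *)

Lemma height_next w p : gauss_word w -> p \in w ->
  height w (next w p) = height w p + flag_sign p.
Proof.
move=> gw pw; have tot := flag_sum_gauss gw; have uw := gauss_word_uniq gw.
rewrite next_nth pw; case: w => // y s in gw pw tot uw *.
set i := index p (y :: s); have i_lt : (i < size (y :: s))%N by rewrite index_mem.
have <- : flag_sum (take i.+1 (y :: s)) = height (y :: s) p + flag_sign p.
  rewrite (take_nth y) // -cats1 flag_sum_cat flag_sum_cons flag_sum_nil addr0.
  by rewrite nth_index.
have [lt|ge] := ltnP i (size s).
  by rewrite -[nth y s i]/(nth y (y :: s) i.+1) /height index_uniq.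
(* At the last passage [next] returns to the head; its height 0 is the total flag sum. *)
by rewrite nth_default // take_oversize // tot /height /= eqxx flag_sum_nil.
Qed.

Lemma sum_passages_at w (V : nmodType) (h : passage -> V) c :
  gauss_word w -> (c, true) \in w ->
  \sum_(q <- w | q.1 == c) h q = h (c, true) + h (c, false).
Proof.
move=> gw tw; rewrite -big_filter.
rewrite (perm_big [:: (c, true); (c, false)]) /=.
  by rewrite !big_cons big_nil addr0.
apply: uniq_perm => [||[d b]].
- by rewrite filter_uniq ?gauss_word_uniq.
- by rewrite /= inE xpair_eqE andbF.
rewrite mem_filter !inE !xpair_eqE /=.
by case: eqP => //= ->; rewrite (mem_gauss gw tw); case: b.
Qed.

Lemma sum_next w (V : nmodType) (h : passage -> passage -> V) : uniq w ->
  \sum_(p <- w) h p (next w p) = \sum_(q <- w) h (prev w q) q.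
Proof.
move=> uw; transitivity (\sum_(q <- map (next w) w) h (prev w q) q).
  by rewrite big_map; apply: eq_bigr => p _; rewrite prev_next.
apply: perm_big; apply: uniq_perm => //.
  by rewrite map_inj_uniq //; exact: (can_inj (prev_next uw)).
move=> q; apply/mapP/idP => [[p pw ->]|qw]; first by rewrite mem_next.
by exists (prev w q); rewrite ?mem_prev ?next_prev.
Qed.

Lemma sum_indicatorB n (u : 'I_n -> rat) a b :
  \sum_i u i * ((a == i)%:R - (b == i)%:R) = u a - u b.
Proof.
have S c : \sum_i u i * (c == i)%:R = u c.
  rewrite (bigD1 c) //= eqxx mulr1 big1 ?addr0 // => i ic.
  by rewrite eq_sym (negbTE ic) mulr0.
under eq_bigr do rewrite mulrBr.
by rewrite sumrB !S.
Qed.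

(** The left kernel lies in the line of constant vectors, so its dimension is at most 1. *)
Lemma rank_constant_kernel m n (A : 'M[rat]_(m, n)) :
  (forall u : 'rV_m, u *m A = 0 -> forall i j, u 0 i = u 0 j) ->
  (m.-1 <= \rank A)%N.
Proof.
move=> cst; have : (kermx A <= (const_mx 1 : 'rV_m))%MS.
  apply/row_subP=> i; have r0 : row i (kermx A) *m A = 0.
    by rewrite -row_mul mulmx_ker row0.
  case: m A cst i r0 => [|m] A cst i r0; first by have := ltn_ord i.
  have -> : row i (kermx A) = row i (kermx A) 0 0 *: const_mx 1.
    by apply/rowP=> j; rewrite [RHS]mxE [const_mx _ _ _]mxE mulr1; exact: cst.
  exact: scalemx_sub.
move/mxrankS; rewrite mxrank_ker => le.
have := leq_trans le (rank_leq_row _); clear; lia.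
Qed.

(* With D the coboundary from regions to edges and B the one from edges to
   double points, D B = 0, and connectedness bounds the ranks of D and B from
   below; Euler's formula then makes the sequence exact, and the cochain 1 is
   killed by B. *)
Lemma alexander_numbering w : gauss_word w -> planar w ->
  exists phi : passage * bool -> rat,
    {in darts w, forall d, phi (turn_left w d) = phi d} /\
    {in w, forall p, phi (p, true) = phi (p, false) + 1}.
Proof.
move=> gw; have uw := gauss_word_uniq gw.
case: (eqVneq w [::]) => [-> _|w0]; first by exists (fun=> 0).
rewrite /planar (negbTE w0) /= => /eqP euler.
have [fi [fi_turn fi_surj]] := region_labelling gw w0.
pose dp := double_points w.
pose e (j : 'I_(size w)) := tnth (in_tuple w) j.
pose vtx (v : 'I_(size dp)) := tnth (in_tuple dp) v.
have sum_e (h : passage -> rat) : \sum_j h (e j) = \sum_(p <- w) h p.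
  by rewrite [RHS](big_tnth _ _ w).
pose D : 'M[rat]_(nb_regions w, size w) :=
  \matrix_(i, j) ((fi (e j, true) == i)%:R - (fi (e j, false) == i)%:R).
pose B : 'M[rat]_(size w, size dp) :=
  \matrix_(j, v) (((next w (e j)).1 == vtx v)%:R - ((e j).1 == vtx v)%:R).
have mulD (u : 'rV_(nb_regions w)) j :
    (u *m D) 0 j = u 0 (fi (e j, true)) - u 0 (fi (e j, false)).
  by rewrite mxE -sum_indicatorB; apply: eq_bigr => i _; rewrite !mxE.
(* [B] measures net flow: what arrives at the double point minus what leaves it. *)
have mulB (g : passage -> rat) v :
    \sum_j g (e j) * B j v = \sum_(q <- w | q.1 == vtx v) (g (prev w q) - g q).
  under eq_bigr do rewrite mxE.
  rewrite (sum_e (fun p => g p * (((next w p).1 == vtx v)%:R - (p.1 == vtx v)%:R))).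
  under eq_bigr do rewrite mulrBr.
  rewrite sumrB (sum_next (fun p q => g p * (q.1 == vtx v)%:R) uw) -sumrB.
  rewrite [RHS]big_mkcond; apply: eq_bigr => q _.
  by case: (_ == _); rewrite ?mulr1 ?mulr0 ?subrr.
have vtxw v : (vtx v, true) \in w.
  have : vtx v \in dp by exact: mem_tnth.
  by rewrite mem_undup => /mapP[p pw ->]; exact: (mem_gauss gw pw).
(* Each of the four corners at a double point occurs once with each sign. *)
have DB0 : D *m B = 0.
  apply/matrixP=> i v; rewrite [RHS]mxE mxE.
  pose g p : rat := (fi (p, true) == i)%:R - (fi (p, false) == i)%:R.
  rewrite (eq_bigr (fun j => g (e j) * B j v)); last by move=> j _; rewrite mxE.
  rewrite mulB sum_passages_at // /g.
  have [-> -> <- ->] := corners gw fi_turn (vtxw v).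
  by clear; ring.
have rD : ((nb_regions w).-1 <= \rank D)%N.
  apply: rank_constant_kernel => u uD i i'.
  have [d dw <-] := fi_surj i; have [d' dw' <-] := fi_surj i'.
  apply: (@regions_connected w rat (fun d => u 0 (fi d))) => // [x xw|p pw].
    by rewrite fi_turn.
  have [j <-] : exists j, e j = p by have [j ->] := seq_tnthP pw; exists j.
  by apply/eqP; rewrite -subr_eq0 -mulD uD mxE.
have rB : ((size dp).-1 <= \rank B)%N.
  rewrite -mxrank_tr; apply: rank_constant_kernel => u uB.
  (* [U] extends [u] from vertex indices to names, so that it can be followed along the curve. *)
  pose U (c : nat) := \sum_v u 0 v * (c == vtx v)%:R.
  have uU v : u 0 v = U (vtx v).
    rewrite /U (bigD1 v) //= eqxx mulr1 big1 ?addr0 // => v' nv.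
    rewrite (_ : _ == _ = false) ?mulr0 //; apply/eqP=> ev; case/eqP: nv.
    move/eqP: ev; rewrite /vtx !(tnth_nth 0%N) nth_uniq ?undup_uniq ?ltn_ord //.
    by move/eqP/val_inj.
  move=> v v'; rewrite !uU.
  apply: (next_constant (g := fun p => U p.1) uw _ (vtxw v) (vtxw v')) => p pw.
  have [j <-] : exists j, e j = p by have [j ->] := seq_tnthP pw; exists j.
  apply: subr0_eq; rewrite /U -sumrB; transitivity ((u *m B^T) 0 j).
    by rewrite mxE; apply: eq_bigr => v0 _; rewrite !mxE mulrBr.
  by rewrite uB mxE.
have size_dp : (size w <= (size dp).*2)%N.
  have sub : {subset w <= [seq (c, b) | c <- dp, b <- [:: true; false]]}.
    move=> p pw; apply/allpairsP; exists p.
    by split=> //; [exact: mem_double_points | case: (p.2) | case: (p)].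
  by have := uniq_leq_size uw sub; rewrite size_allpairs /= muln2.
(* With E edges, N double points and R regions, the kernel of [B] has dimension at most E - (N - 1),
   which is at most E/2 + 1 = R - 1, hence at most the rank of [D]. *)
have kB : (kermx B <= D)%MS.
  rewrite -(geq_leqif (mxrank_leqif_sup _)); last exact/sub_kermxP.
  rewrite mxrank_ker; move: rD rB euler size_dp; clear; lia.
have : ((const_mx 1 : 'rV_(size w)) <= D)%MS.
  apply: submx_trans kB; apply/sub_kermxP/rowP=> v.
  rewrite [RHS]mxE mxE.
  transitivity (\sum_j (fun=> 1 : rat) (e j) * B j v).
    by apply: eq_bigr => j _; rewrite [const_mx _ _ _]mxE.
  by rewrite (mulB (fun=> 1)) big1 // => q _; rewrite subrr.
case/submxP=> X eX; exists (fun d => X 0 (fi d)).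
split=> [d dw|p pw]; first by rewrite fi_turn.
have [j <-] : exists j, e j = p by have [j ->] := seq_tnthP pw; exists j.
have /rowP/(_ j) := eX; rewrite mulD mxE => ->; by clear; ring.
Qed.

(** Passing through a crossing changes the label on the left of the curve by the flag, so label and
    height differ by a constant along the curve. The corners at [c] make the labels of its two
    outgoing edges differ by exactly 1, which fixes the difference of the two heights. *)
Lemma planar_chord_index w c : gauss_word w -> planar w ->
  (c, true) \in w -> chord_index w c = 0.
Proof.
move=> gw pw tw; have uw := gauss_word_uniq gw.
have fw : (c, false) \in w by exact: (mem_gauss gw tw).
have [phi [inv jump]] := alexander_numbering gw pw.
pose a p := phi (p, true).
have jump' p : p \in w -> phi (p, false) = a p - 1.
  by move=> /jump ap; rewrite /a ap addrK.
have turn c' : (c', true) \in w -> let t := (c', true) in let f := (c', false) in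
    [/\ a t = a f + 1, a (prev w f) = a t & a (prev w t) = a f].
  move=> tw' t f; have fw' : f \in w by exact: (mem_gauss gw tw').
  have [e1 e2 e3 e4] := corners gw inv tw'; rewrite -/t -/f in e1 e2 e3 e4.
  rewrite !jump' ?mem_prev // in e1 e3 e4.
  split=> //; last by apply: (addIr (-1)); rewrite e3.
  by rewrite /a -e4 subrK.
have step p : p \in w -> a p = a (prev w p) + (flag_sign p)%:~R.
  move=> p_w; have [] := turn p.1 (mem_gauss gw p_w true).
  by case: p p_w => d [] _ /= e1 e2 e3; rewrite ?e2 ?e3 e1 ?addrK.
(* [a p] belongs to the edge leaving [p], so the flag of [p] is added to the height. *)
pose g p := a p - (height w p + flag_sign p)%:~R.
have gc : g (c, true) = g (c, false).
  apply: (next_constant uw) => // p p_w.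
  rewrite /g step ?mem_next // prev_next // height_next //.
  by rewrite !intrD; clear; ring.
have [e1 _ _] := turn c tw; move: gc; rewrite /g e1 /chord_index.
move: (height _ _) (height _ _) => x y h.
have : (x - y - 1)%:~R = 0 :> rat.
  by move: h; rewrite /flag_sign /= !(intrD, mulrNz) /=; clear; lra.
by move/eqP; rewrite intr_eq0 => /eqP.
Qed.

(** * Classical diagrams and the lower bound *)

Lemma classical_writhe D : is_classical D -> diagram_writhe D = 0.
Proof.
case=> D' [/diagram_writhe_invariant <- noV].
have gD := gauss_word_curve D'; have pD : planar D' by case: (curve D') => w /= /andP[].
have -> : diagram_writhe D' = index_writhe (kind D') D'.
  congr index_writhe; apply/all_filterP/allP=> p /mem_double_points/noV.
  by rewrite /classical_crossing; case: (kind _ _).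
rewrite /index_writhe big_seq_cond big_pred0 // => p; apply/negP.
by case/andP=> pw; rewrite planar_chord_index ?eqxx // (mem_gauss gD pw).
Qed.

Lemma reduced_resolve S r :
  reduced (kind (resolve S r)) S = [seq p <- word S | ~~ is_virtual S p.1].
Proof.
by apply: eq_filter => p; rewrite /classical_crossing /=; case: ifP => // _; case: ifP.
Qed.

(* Resolving c in two ways that agree elsewhere changes the writhe by 2 for
   each of the two passages of c. *)
Lemma ind_neq0_resolved S (P : seq nat) r c :
  (forall r', {in P, r' =1 r} -> is_classical (resolve S r')) ->
  c \in precrossings S -> ind S c != 0 -> c \in P.
Proof.
move=> allcl cS c0; have J := ind_chord_index cS c0.
apply/negPn/negP => cP.
pose s b x := if x == c then b else r x.
have W b : diagram_writhe (resolve S (s b)) = 0.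
  apply: classical_writhe; apply: allcl => x xP; rewrite /s.
  by case: eqP => // e; rewrite -e xP in cP.
have : diagram_writhe (resolve S (s true)) - diagram_writhe (resolve S (s false)) = 0.
  by rewrite !W.
(* All resolutions share one reduced word, hence the same indices, and the writhes can be subtracted
   term by term. *)
rewrite /diagram_writhe !reduced_resolve; set v := seq.filter _ _ in J *.
rewrite /index_writhe -sumrB /=.
move: cS; rewrite mem_filter => /andP[cV cS].
rewrite (eq_bigr (fun p => if p.1 == c then 2 else 0)) => [|p _]; last first.
  rewrite /s; case: eqP => [->|_]; last by rewrite subrr.
  by rewrite (negbTE cV).
have gv : gauss_word v.
  exact: (gauss_word_filter (fun x => ~~ is_virtual S x) (gauss_word_curve S)).
have cv : (c, true) \in v.
  move: cS; rewrite mem_undup mem_filter cV /= => /mapP[p pS ->].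
  exact: (mem_gauss (gauss_word_curve S) pS).
rewrite -big_mkcondr /= (eq_bigl (fun p => p.1 == c)); last first.
  by move=> p; case: (p.1 =P c) => [->|_]; rewrite ?andbF ?J.
by rewrite (sum_passages_at (fun=> 2)).
Qed.

Theorem proposition5p5 (S : shadow) :
  enat_ge (cl S)
    (\big[addn/0%N]_(m \in [set m : int | m != 0%R]%classic) size (C_ S m)).
Proof.
rewrite sum_size_C /cl; case: pselect => //= ex.
case: ex_minnP => n /asboolP[P [_ _ <- [r allcl]]] _.
apply: uniq_leq_size => [|c]; first by rewrite !filter_uniq ?undup_uniq.
by rewrite mem_filter => /andP[c0 cS]; exact: ind_neq0_resolved allcl cS c0.
Qed.
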